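(* Let $n\ge 1$ and $0\le k\le n-1$ be integers. The number of partitions $\pi$ into distinct parts with $\mathrm{rank}(\pi)=k$ and $\Gamma(\pi)=n$ equals the number of partitions $\lambda$ into odd parts with $\ell(\lambda)=k+1$ and $\Gamma(\lambda)=n$. When $k\equiv n-1\pmod 2$, both numbers equal $\binom{(n+k-1)/2}{k}$.
   Context: For a non-empty partition $\pi=(\pi_1\ge\cdots\ge\pi_r\ge1)$, $\ell(\pi)=r$, $\Gamma(\pi)=\pi_1+\ell(\pi)-1$ (length of the largest hook) and $\mathrm{rank}(\pi)=\pi_1-\ell(\pi)$. *)

(* Defs.v *)
From mathcomp Require Import all_boot all_order all_algebra finmap.
From mathcomp Require Import boolp classical_sets functions cardinality.
Set Implicit Arguments.
Unset Strict Implicit.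
Unset Printing Implicit Defensive.

Local Open Scope nat_scope.

(* Partitions, of no prescribed size, are listed in weakly decreasing order.
   The empty one is excluded. *)
Definition is_partition (p : seq nat) : bool :=
  [&& p != [::], sorted geq p & all (leq 1) p].

Definition largest_part (p : seq nat) : nat := head 0 p.

Definition hook_length (p : seq nat) : nat := largest_part p + size p - 1.

Definition partition_rank (p : seq nat) : int :=
  ((largest_part p)%:Z - (size p)%:Z)%R.

Definition distinct_partitions (n k : nat) : set (seq nat) :=
  [set p | [/\ is_partition p, uniq p, partition_rank p = (k%:Z)%R
             & hook_length p = n]]%classic.

Definition odd_partitions (n m : nat) : set (seq nat) :=
  [set p | [/\ is_partition p, all odd p, size p = m
             & hook_length p = n]]%classic.

(* Main.v *)
(** Read a partition off its largest part [a], listing the other parts in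
    increasing order.  A partition into distinct parts has rank k and largest
    hook n iff, for some c, n = k + 2c + 1, a = k + c + 1 and there are c other
    parts; these form an arbitrary c-subset of {1, ..., k + c}.  A partition into
    odd parts has k + 1 parts and largest hook n iff n = k + 2c + 1 for the c with
    a = 2c + 1; the other parts form an arbitrary k-multiset of
    {1, 3, ..., 2c + 1}.  Both are counted by 'C(k + c, k), and both families are
    empty when n - 1 - k is odd. *)
Require Import Defs.
From mathcomp Require Import all_boot all_order all_algebra finmap.
From mathcomp Require Import boolp classical_sets functions cardinality.
From mathcomp Require Import zify.
Local Open Scope nat_scope.

(** Reduces counting a set of partitions to counting increasing tuples of ordinals. *)
Lemma card_injective_image (T : finType) (U : choiceType) (A : {set T})
    (f : T -> U) (X : set U) :
  injective f -> (forall x, X x <-> exists2 t, t \in A & x = f t) ->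
  finite_set X /\ #|` fset_set X|%fset = #|A|.
Proof.
move=> f_inj XP.
have -> : X = [set` [fset f t | t in A]%fset]%classic.
  apply/funext => x; apply/propext; split=> [/XP[t tA ->]|].
    by apply/imfsetP; exists t.
  by move=> /imfsetP[t /= tA ->]; apply/XP; exists t.
split; first exact: finite_fset.
by rewrite set_fsetK card_imfset // cardE.
Qed.

(** The map [f] enumerates the allowed parts; the reversal lets increasing tuples, whose numbers are
    known binomials, encode decreasing parts. *)
Definition partition_of (f : nat -> nat) (a m r : nat) (t : r.-tuple 'I_m) :
  seq nat := a :: rev [seq f (val i) | i <- t].

Lemma partition_of_inj f a m r :
  injective f -> injective (@partition_of f a m r).
Proof.
move=> f_inj t u [/(can_inj revK) /inj_map eq_tu].
by apply/val_inj/eq_tu => i j /f_inj /val_inj.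
Qed.

Lemma sorted_geq_partition_of f a m r (t : r.-tuple 'I_m) :
  (forall i, i < m -> f i <= a) -> {mono f : i j / i <= j} ->
  sorted geq (partition_of f a m r t) = sorted leq [seq val i | i <- t].
Proof.
move=> f_le f_mono; rewrite /partition_of /= path_sortedE; last first.
  by move=> y x z /= xy yz; apply: leq_trans xy.
rewrite all_rev all_map (@eq_all _ _ predT) => [|i]; last first.
  by rewrite /= f_le.
rewrite all_predT /= rev_sorted (map_comp f) sorted_map.
by apply: eq_sorted => i j /=; rewrite f_mono.
Qed.

(** Decoding: [g] has to invert [f] only on the entries of [q], which suits [predn] on positive
    parts and [half] on odd ones. *)
Lemma partition_ofP (f g : nat -> nat) a m (q : seq nat) :
  (forall x, x \in q -> g x < m /\ f (g x) = x) ->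
  (* [pmap insub] discards nothing, since each [g x] is below [m]. *)
  exists t : (size q).-tuple 'I_m, a :: q = partition_of f a m (size q) t.
Proof.
move=> qP; pose s := pmap insub (map g (rev q)) : seq 'I_m.
have val_s : map val s = map g (rev q).
  rewrite /s pmap_filter; last exact: insubK.
  apply/all_filterP/allP => y /mapP[x]; rewrite mem_rev => /qP[gx _] ->.
  by rewrite isSome_insub.
have size_s : size s == size q.
  by rewrite -(size_map val) val_s size_map size_rev.
exists (Tuple size_s); rewrite /partition_of /= (map_comp f) val_s -map_comp.
rewrite map_id_in ?revK // => x; rewrite mem_rev => /qP[_]; exact.
Qed.

Lemma distinct_partitionsP k c p :
  distinct_partitions (k + c.*2).+1 k p <->
  exists2 t : c.-tuple 'I_(k + c),
    t \in [set t : c.-tuple 'I_(k + c) | sorted ltn [seq val i | i <- t]]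
    & p = partition_of succn (k + c).+1 (k + c) c t.
Proof.
rewrite /distinct_partitions /= /is_partition /partition_rank.
rewrite /hook_length /largest_part; split.
  case: p => [|a q] [] // /and3P[_ srt pos] unq /= rk hk.
  have ac : a = (k + c).+1 by lia.
  have cq : c = size q by lia.
  (* Strict decrease puts the other parts below [a], so their predecessors are below [k + c]. *)
  have : sorted gtn (a :: q) by rewrite gtn_sorted_uniq_geq unq srt.
  rewrite /= path_sortedE => [/andP[qa sq]|]; last first.
    by move=> y x z /= xy yz; apply: ltn_trans xy.
  case: (@partition_ofP succn predn a (k + c) q) => [x xq|].
    have := allP qa _ xq; have := allP pos x.
    by rewrite inE xq orbT => /(_ isT) /=; lia.
  rewrite -cq ac => t tP; exists t => //; rewrite inE.
  by move: sq; case: tP => ->; rewrite rev_sorted (map_comp succn) sorted_map.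
case=> t; rewrite inE ltn_sorted_uniq_leq => /andP[unq srt] ->.
have sz : size (partition_of succn (k + c).+1 (k + c) c t) = c.+1.
  by rewrite /= size_rev size_map size_tuple.
rewrite sz; split; [| | by rewrite /=; lia | by rewrite /=; lia].
- rewrite sorted_geq_partition_of ?srt //=; last by move=> i /ltnW.
  by rewrite all_rev all_map; apply/allP.
- rewrite /= mem_rev rev_uniq (map_comp succn) map_inj_uniq ?unq ?andbT //;
    last exact: succn_inj.
  (* The largest part cannot recur: it would need the index [k + c], which is out of range. *)
  apply/negP => /mapP[_ /mapP[i _ ->]] [eq_i].
  by have := ltn_ord i; rewrite -eq_i ltnn.
Qed.

Lemma odd_partitionsP k c p :
  odd_partitions (k + c.*2).+1 k.+1 p <->
  exists2 t : k.-tuple 'I_c.+1,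
    t \in [set t : k.-tuple 'I_c.+1 | sorted leq [seq val i | i <- t]]
    & p = partition_of (fun i => i.*2.+1) c.*2.+1 c.+1 k t.
Proof.
have f_mono : {mono (fun i => i.*2.+1) : i j / i <= j}.
  by move=> i j; rewrite ltnS leq_double.
have f_le i : i < c.+1 -> i.*2.+1 <= c.*2.+1 by rewrite f_mono.
rewrite /odd_partitions /= /is_partition /hook_length /largest_part; split.
  case: p => [|a q] [] // /and3P[_ srt _] /andP[_ odd_q] /= [sz] hk.
  have ac : a = c.*2.+1 by lia.
  move: (srt); rewrite /= path_sortedE => [/andP[qa _]|]; last first.
    by move=> y x z /= xy yz; apply: leq_trans xy.
  case: (@partition_ofP (fun i => i.*2.+1) half a c.+1 q) => [x xq|].
    by have := allP qa _ xq; have := allP odd_q _ xq; rewrite /=; lia.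
  rewrite sz ac => t tP; exists t => //; rewrite inE.
  by rewrite -(sorted_geq_partition_of _ _ _ _ t f_le f_mono) -tP -ac.
case=> t; rewrite inE => srt ->.
have sz : size (partition_of (fun i => i.*2.+1) c.*2.+1 c.+1 k t) = k.+1.
  by rewrite /= size_rev size_map size_tuple.
split; [| | exact: sz | by rewrite sz /=; lia].
- rewrite sorted_geq_partition_of // srt /=.
  by rewrite all_rev all_map; apply/allP.
- rewrite /= odd_double all_rev all_map.
  by apply/allP => i _ /=; rewrite odd_double.
Qed.

(** Hook length minus rank is twice the number of parts, minus one. *)
Lemma distinct_partitions_parity n k p :
  distinct_partitions n k p -> exists c, n = (k + c.*2).+1.
Proof.
rewrite /distinct_partitions /= /partition_rank /hook_length.
case: p => [|a q] [] // _ _ /= rk hk; exists (size q); lia.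
Qed.

(** With [k.+1] parts the hook length is [a + k], and [a] is odd. *)
Lemma odd_partitions_parity n k p :
  odd_partitions n k.+1 p -> exists c, n = (k + c.*2).+1.
Proof.
rewrite /odd_partitions /= /hook_length.
case: p => [|a q] [] // _ /andP[odd_a _] /= [sz] hk; exists a./2; lia.
Qed.

Theorem theorem2p11 (n k : nat) (hn : 1 <= n) (hk : k <= n - 1) :
  [/\ finite_set (distinct_partitions n k),
      finite_set (odd_partitions n k.+1),
      #|` fset_set (distinct_partitions n k)|%fset
        = #|` fset_set (odd_partitions n k.+1)|%fset
    & k = n - 1 %[mod 2] ->
      #|` fset_set (distinct_partitions n k)|%fset = 'C((n + k - 1) %/ 2, k)
      /\ #|` fset_set (odd_partitions n k.+1)|%fset
           = 'C((n + k - 1) %/ 2, k)].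
Proof.
have [par|npar] := eqVneq (k %% 2) ((n - 1) %% 2).
  pose c := (n - 1 - k)./2.
  have -> : n = (k + c.*2).+1 by rewrite /c; lia.
  have [finD cardD] := card_injective_image _ _ _ _ _
    (partition_of_inj _ _ _ _ succn_inj) (distinct_partitionsP k c).
  have [|finO cardO] := card_injective_image _ _ _ _ _
    (partition_of_inj _ _ _ _ _) (odd_partitionsP k c).
    by move=> i j [/double_inj].
  have -> : ((k + c.*2).+1 + k - 1) %/ 2 = k + c by lia.
  (* The subsets give ['C(k + c, c)] and the multisets ['C(k + c, k)], equal by symmetry. *)
  rewrite cardD cardO card_ltn_sorted_tuples card_sorted_tuples.
  by rewrite -(bin_sub (leq_addr c k)) addKn.
(* In the other parity both families are empty, so the counts agree trivially. *)
have absurd c : n <> (k + c.*2).+1 by move: npar => /eqP; lia.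
have -> : distinct_partitions n k = set0.
  by rewrite -subset0 => p /distinct_partitions_parity[c /absurd].
have -> : odd_partitions n k.+1 = set0.
  by rewrite -subset0 => p /odd_partitions_parity[c /absurd].
by rewrite fset_set0; split=> //; move/eqP; rewrite (negPf npar).
Qed.
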